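(* Let $R$ be a Noetherian one-dimensional local domain that is analytically irreducible and residually rational, with $\operatorname{char}(R)\ne 2$, and let $v$ be the valuation of $\overline{R}$. Let $I$ be a nonzero ideal of $R$ and let $b\in R$ be such that $m=v(b)$ is odd. Let $\mathcal{R}=R[It]/\big((t^2-b)\cap R[It]\big)\subseteq R[\alpha]$, where $\alpha=t+(t^2-b)$. Then $\mathcal{R}$ is a Noetherian one-dimensional local domain that is analytically irreducible and residually rational. Moreover, if $v':Q(R)[\alpha]\to\mathbb{Z}$ (defined on nonzero elements) is the extension to $Q(R)[\alpha]$ of the valuation of the discrete valuation ring $\overline{\mathcal{R}}$, then $v'_{|Q(R)}=2v$, $v'(\alpha)=m$ and $$v'(\mathcal{R})=v(R)\Join^{v(b)}v(I).$$
   Context: For a domain $A$, $Q(A)$ is its field of fractions and $\overline{A}$ its integral closure in $Q(A)$. A Noetherian one-dimensional local domain $(A,\mathfrak{n})$ is analytically irreducible if its completion is a domain, equivalently if $\overline{A}$ is a discrete valuation ring (DVR) and a finitely generated $A$-module; it is then residually rational if the natural map from $A/\mathfrak{n}$ to the residue field of $\overline{A}$ is an isomorphism. The valuation of the DVR $\overline{A}$ is normalized, with value group $\mathbb{Z}$; for a subset $X$ of $Q(A)$, its set of values is the set of values of nonzero elements of $X$. Thus $v(R)$ is a numerical semigroup (a submonoid of $\mathbb{N}$ with finite complement) and $v(I)$ is a semigroup ideal of it. The Rees algebra is $R[It]=\bigoplus_{n\in\mathbb{N}}I^nt^n\subseteq R[t]$, $t$ an indeterminate, and $(t^2-b)$ is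 the ideal generated by $t^2-b$ in $R[t]$; $R[\alpha]=R[t]/(t^2-b)$. The ring $\mathcal{R}$ is identified with the subring $R+I\alpha$ of $R[\alpha]$, and its field of fractions is $Q(R)[\alpha]=Q(R)[t]/(t^2-b)$. For a numerical semigroup $S$, a semigroup ideal $E\subseteq S$ ($E+S\subseteq E$) and an odd $m\in S$, the numerical duplication is $S\Join^m E=\{2s:s\in S\}\cup\{2e+m:e\in E\}$. *)

(* Defs.v *)
From HB Require Import structures.
From mathcomp Require Import all_boot all_order all_algebra.
From mathcomp Require Import boolp classical_sets.

Set Implicit Arguments.
Unset Strict Implicit.
Unset Printing Implicit Defensive.

Import Order.TTheory GRing.Theory Num.Theory.
Local Open Scope classical_set_scope.
Local Open Scope ring_scope.
Local Open Scope quotient_scope.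

Section Ideals.
Variable A : comNzRingType.
Implicit Types B I J P : set A.

(* Ideals of a subring B of A; the ideals of A itself are those of setT. *)
Definition ideal_of B J :=
  [/\ J `<=` B, J 0, forall x y, J x -> J y -> J (x + y)
    & forall a x, B a -> J x -> J (a * x)].

Definition maximal_ideal_of B M :=
  [/\ ideal_of B M, ~ M 1
    & forall J, ideal_of B J -> ~ J 1 -> M `<=` J -> J = M].

Definition is_ideal I := ideal_of [set: A] I.

Definition prime_ideal P :=
  [/\ is_ideal P, ~ P 1 & forall x y, P (x * y) -> P x \/ P y].

Definition prime_chain (n : nat) :=
  exists P : 'I_n.+1 -> set A,
    (forall i, prime_ideal (P i)) /\
    (forall i j : 'I_n.+1, (i < j)%N -> P i `<` P j).

Definition has_krull_dim (n : nat) := prime_chain n /\ ~ prime_chain n.+1.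

Definition is_local := exists! M, maximal_ideal_of [set: A] M.

End Ideals.

(* M is a finitely generated module over A, which acts on K through f. *)
Definition fin_gen (A K : comNzRingType) (f : A -> K) (M : set K) :=
  exists (n : nat) (g : 'I_n -> K),
    M = [set x | exists c : 'I_n -> A, x = \sum_(i < n) f (c i) * g i].

Definition noetherian (A : comNzRingType) :=
  forall I : set A, is_ideal I -> fin_gen idfun I.

Definition noetherian_1dim_local_domain (A : comNzRingType) :=
  [/\ GRing.integral_domain_axiom A, noetherian A, has_krull_dim A 1
    & is_local A].

(* The value of v at 0 is irrelevant. *)
Definition discrete_valuation (K : nzRingType) (v : K -> int) :=
  [/\ forall x y, x != 0 -> y != 0 -> v (x * y) = v x + v y,
      forall x y, x != 0 -> y != 0 -> x + y != 0 ->
        Num.min (v x) (v y) <= v (x + y)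
    & forall n : int, exists2 x, x != 0 & v x = n].

Definition valuation_ring (K : nzRingType) (v : K -> int) : set K :=
  [set x | x != 0 -> 0 <= v x].

Definition normalized_valuation_of (K : nzRingType) (V : set K) (v : K -> int) :=
  discrete_valuation v /\ V = valuation_ring v.

Definition is_dvr (K : nzRingType) (V : set K) :=
  exists v, normalized_valuation_of V v.

Definition values (K : nzRingType) (v : K -> int) (X : set K) : set int :=
  [set n | exists x, [/\ X x, x != 0 & v x = n]].

Definition numerical_duplication (S E : set int) (m : int) : set int :=
  [set 2 * s | s in S] `|` [set 2 * e + m | e in E].

Section FractionField.
Variables (A : comNzRingType) (K : comUnitRingType) (f : {rmorphism A -> K}).

Definition is_fraction_field :=
  [/\ forall x : K, x != 0 -> x \is a GRing.unit, injective f
    & forall x : K, exists a s, s != 0 /\ x = f a / f s].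

(* In the next definitions, K stands for the fraction field of A. *)
Definition integral_closure : set K := [set x | integralOver f x].

Definition analytically_irreducible :=
  is_dvr integral_closure /\ fin_gen f integral_closure.

(* The first condition says that the map from A / N to the residue field of
   the integral closure is well defined and injective, the second that it is
   surjective. *)
Definition residually_rational :=
  forall (N : set A) (M : set K),
    maximal_ideal_of [set: A] N -> maximal_ideal_of integral_closure M ->
    (forall a, N a <-> M (f a)) /\
    (forall x, integral_closure x -> exists a, M (x - f a)).

End FractionField.

Section Rees.
Variable R : idomainType.

Definition ideal_mul (I J : set R) : set R :=
  [set x | exists (n : nat) (a c : 'I_n -> R),
    [/\ forall i, I (a i), forall i, J (c i) & x = \sum_(i < n) a i * c i]].

Definition ideal_pow (I : set R) (n : nat) : set R :=
  iter n (ideal_mul I) [set: R].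

Lemma ideal_mul0 I J : ideal_mul I J 0.
Proof.
exists 0%N, (fun=> 0), (fun=> 0).
by split=> [[]//|[]//|]; rewrite big_ord0.
Qed.

Lemma ideal_mulD I J x y :
  ideal_mul I J x -> ideal_mul I J y -> ideal_mul I J (x + y).
Proof.
move=> [n [a [c [Ia Jc ->]]]] [p [a' [c' [Ia' Jc' ->]]]].
pose glue (u : 'I_n -> R) (w : 'I_p -> R) (i : 'I_(n + p)) :=
  match split i with inl j => u j | inr j => w j end.
exists (n + p)%N, (glue a a'), (glue c c'); split.
- by move=> i; rewrite /glue; case: split.
- by move=> i; rewrite /glue; case: split.
rewrite big_split_ord /=; congr (_ + _); apply: eq_bigr => i _; rewrite /glue.
  by rewrite -[lshift p i]/(unsplit (inl i)) unsplitK.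
by rewrite -[rshift n i]/(unsplit (inr i)) unsplitK.
Qed.

Lemma ideal_pow0 I n : ideal_pow I n 0.
Proof. by case: n => [//|n]; exact: ideal_mul0. Qed.

Lemma ideal_powD I n x y :
  ideal_pow I n x -> ideal_pow I n y -> ideal_pow I n (x + y).
Proof. by case: n => [//|n]; exact: ideal_mulD. Qed.

Lemma ideal_powM I m n x y :
  ideal_pow I m x -> ideal_pow I n y -> ideal_pow I (m + n) (x * y).
Proof.
elim: m n x y => [|m IHm] n x y.
  elim: n x y => [//|n IHn] x y _ [k [a [c [Ia Jc ->]]]].
  exists k, a, (fun i => x * c i); split=> // [i|]; first by apply: IHn (Jc i).
  by rewrite mulr_sumr; apply: eq_bigr => i _; rewrite mulrCA.
move=> [k [a [c [Ia Jc ->]]]] Iy.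
exists k, a, (fun i => c i * y); split=> // [i|]; first exact: IHm (Jc i) Iy.
by rewrite mulr_suml; apply: eq_bigr => i _; rewrite mulrA.
Qed.

Definition rees (I : set R) : {pred {poly R}} :=
  fun p => `[< forall n, ideal_pow I n p`_n >].

Fact rees_subring_closed I : subring_closed (rees I).
Proof.
split=> [|p q /asboolP Ip /asboolP Iq|p q /asboolP Ip /asboolP Iq];
  apply/asboolP => n.
- by rewrite coef1; case: n => [|n] //=; exact: ideal_mul0.
- rewrite coefB; apply: ideal_powD => //.
  by rewrite -mulN1r -[n]add0n; exact: ideal_powM.
- rewrite coefM; apply: (big_ind (ideal_pow I n)).
  + exact: ideal_pow0.
  + by move=> x y; exact: ideal_powD.
  + by move=> i _; rewrite -[in ideal_pow _ _](subnKC (ltn_ord i : (i <= n)%N));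
      exact: ideal_powM.
Qed.

HB.instance Definition _ I :=
  GRing.isSubringClosed.Build {poly R} (rees I) (rees_subring_closed I).

Record rees_algebra (I : set R) : predArgType :=
  ReesAlgebra { rees_val :> {poly R}; _ : rees_val \in rees I }.

HB.instance Definition _ I := [isSub for @rees_val I].
HB.instance Definition _ I := [Choice of rees_algebra I by <:].
HB.instance Definition _ I :=
  [SubChoice_isSubComNzRing of rees_algebra I by <:].

Variable b : R.

Definition rees_rel (I : set R) : {pred rees_algebra I} :=
  fun p => `[< exists q : {poly R}, rees_val p = q * ('X^2 - b%:P) >].

Fact rees_rel_idealr_closed I : idealr_closed (@rees_rel I).
Proof.
split=> [||a p q /asboolP [p' Ep] /asboolP [q' Eq]].
- by apply/asboolP; exists 0; rewrite mul0r.
- apply/asboolPn => -[q] /= /(congr1 (fun p : {poly R} => size p)).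
  rewrite size_poly1.
  have [->|q0] := eqVneq q 0; first by rewrite mul0r size_poly0.
  rewrite size_Mmonic ?size_XnsubC ?monicXnsubC // addn3 /=.
  by move: q0; rewrite -size_poly_gt0; case: (size q).
- apply/asboolP; exists (rees_val a * p' + q') => /=.
  by rewrite Ep Eq mulrDl mulrA.
Qed.

HB.instance Definition _ I :=
  isIdealr.Build (rees_algebra I) (@rees_rel I) (rees_rel_idealr_closed I).

Definition rees_quot (I : set R) := {ideal_quot (@rees_rel I)}.
HB.instance Definition _ I := GRing.ComNzRing.on (rees_quot I).

Definition t2b_frac : {poly {fraction R}} := 'X^2 - (tofrac b)%:P.

(* Q(R)[t] / (t^2 - b): the polynomial is monic of degree 2, so that the
   quotient by mk_monic is the intended one. *)
Definition frac_alpha := {poly %/ t2b_frac}.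
HB.instance Definition _ := GRing.ComUnitRing.on frac_alpha.

Definition frac_to_alpha : {fraction R} -> frac_alpha := qpolyC t2b_frac.
Definition alpha : frac_alpha := 'qX.

Definition rees_eval (I : set R) (p : rees_algebra I) : frac_alpha :=
  in_qpoly t2b_frac (map_poly (@tofrac R) (rees_val p)).

(* The embedding of the quotient into Q(R)[alpha] induced by R[t] -> Q(R)[t]. *)
Definition rees_quot_embed (I : set R) (x : rees_quot I) : frac_alpha :=
  rees_eval (repr x).

Lemma mk_monic_t2b : mk_monic t2b_frac = t2b_frac.
Proof. by rewrite /mk_monic size_XnsubC // monicXnsubC. Qed.

Fact rees_eval_zmod_morphism I : zmod_morphism (@rees_eval I).
Proof. by move=> p q; rewrite /rees_eval /= !rmorphB. Qed.
Fact rees_eval_monoid_morphism I : monoid_morphism (@rees_eval I).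
Proof.
by split=> [|p q]; rewrite /rees_eval /= (rmorph1, rmorphM) ?rmorph1 ?rmorphM.
Qed.
HB.instance Definition _ I := GRing.isZmodMorphism.Build
  (rees_algebra I) frac_alpha (@rees_eval I) (@rees_eval_zmod_morphism I).
HB.instance Definition _ I := GRing.isMonoidMorphism.Build
  (rees_algebra I) frac_alpha (@rees_eval I) (@rees_eval_monoid_morphism I).

Lemma rees_eval_rel I (p : rees_algebra I) :
  p \in @rees_rel I -> rees_eval p = 0.
Proof.
case/asboolP => q Ep; apply/val_inj; rewrite /rees_eval Ep rmorphM.
rewrite rmorphB /= map_polyXn map_polyC mk_monic_t2b /=.
by rewrite Pdiv.RingMonic.rmodp_mull ?monicXnsubC.
Qed.

Lemma rees_quot_embed_pi I (p : rees_algebra I) :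
  rees_quot_embed (\pi_(rees_quot I) p) = rees_eval p.
Proof.
apply/eqP; rewrite /rees_quot_embed -subr_eq0 -rmorphB; apply/eqP.
by apply: rees_eval_rel; rewrite Quotient.idealrBE reprK.
Qed.

Fact rees_quot_embed_zmod_morphism I : zmod_morphism (@rees_quot_embed I).
Proof.
move=> x y; rewrite -[x]reprK -[y]reprK -rmorphB.
by rewrite !rees_quot_embed_pi rmorphB.
Qed.
Fact rees_quot_embed_monoid_morphism I : monoid_morphism (@rees_quot_embed I).
Proof.
split=> [|x y].
  by rewrite -[1](rmorph1 \pi_(rees_quot I)) rees_quot_embed_pi rmorph1.
rewrite -[x]reprK -[y]reprK -rmorphM.
by rewrite !rees_quot_embed_pi rmorphM.
Qed.
HB.instance Definition _ I := GRing.isZmodMorphism.Build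
  (rees_quot I) frac_alpha (@rees_quot_embed I)
  (@rees_quot_embed_zmod_morphism I).
HB.instance Definition _ I := GRing.isMonoidMorphism.Build
  (rees_quot I) frac_alpha (@rees_quot_embed I)
  (@rees_quot_embed_monoid_morphism I).

End Rees.

(* Main.v *)
From HB Require Import structures.
Require Import Defs.
From mathcomp Require Import all_boot all_order all_algebra.
From mathcomp Require Import boolp classical_sets.
From mathcomp Require Import zify ring.

(* Elements of Q(R)[alpha] are written x + y alpha. Since v(b) is odd, the
   valuations of x^2 and b y^2 never agree, so that z |-> v(N z), with
   N(x + y alpha) = x^2 - b y^2, is a discrete valuation w with
   w(x + y alpha) = min(2 v(x), 2 v(y) + v(b)). Its valuation ring is the integral
   closure of R + I alpha: it is integrally closed, and if w(x + y alpha) >= 0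
   then x and (y alpha)^2 = b y^2 are in the integral closure of R. It is
   generated over R by the g_i and the e g_i alpha, where the g_i generate the
   integral closure of R and 2 v(e) = 1 - v(b). A ring whose integral closure is a
   DVR and a finite module is local, and it has dimension 1 because the conductor
   forces some power of any non-unit into any given nonzero ideal. *)

Set Implicit Arguments.
Unset Strict Implicit.
Unset Printing Implicit Defensive.

Import Order.TTheory GRing.Theory Num.Theory.
Local Open Scope classical_set_scope.
Local Open Scope ring_scope.
Local Open Scope quotient_scope.

(** * Discrete valuations and local domains *)

Section DiscreteValuation.
Variables (L : comUnitRingType) (w : L -> int).
Hypothesis unitL : forall x : L, x != 0 -> x \is a GRing.unit.
Hypothesis dw : discrete_valuation w.
Implicit Types (x y : L) (n k : int).

(** [frac_alpha b] is a field only when [b] is not a square, so [L] is a mere unit ring with the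
    hypothesis [unitL], and field facts are derived from invertibility. *)
Lemma field_mulf_neq0 x y : x != 0 -> y != 0 -> x * y != 0.
Proof.
move=> x0 y0; apply: contraTneq (unitL x0) => xy0.
by move: (unitL y0) xy0 => /(divrr) yV /(congr1 (fun z => z / y));
  rewrite -mulrA yV mulr1 mul0r => ->; rewrite unitr0.
Qed.

Lemma field_invr_neq0 x : x != 0 -> x^-1 != 0.
Proof.
by move=> /unitL ux; apply: contraTneq ux => x0; rewrite -unitrV x0 unitr0.
Qed.

Lemma field_expf_neq0 x (n : nat) : x != 0 -> x ^+ n != 0.
Proof.
move=> x0; elim: n => [|n IHn]; first exact: oner_neq0.
by rewrite exprS field_mulf_neq0.
Qed.

Lemma dvalM x y : x != 0 -> y != 0 -> w (x * y) = w x + w y.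
Proof. by case: dw => h _ _; apply: h. Qed.

Lemma dval1 : w 1 = 0.
Proof.
have : w 1 = w 1 + w 1 by rewrite -dvalM ?oner_neq0 // mulr1.
lia.
Qed.

Lemma dvalV x : x != 0 -> w x^-1 = - w x.
Proof.
move=> x0; have := dvalM x0 (field_invr_neq0 x0).
by rewrite divrr ?unitL // dval1; lia.
Qed.

Lemma dvalX x (n : nat) : x != 0 -> w (x ^+ n) = n%:Z * w x.
Proof.
move=> x0; elim: n => [|n IHn]; first by rewrite expr0 dval1 mul0r.
by rewrite exprS dvalM ?field_expf_neq0 // IHn intS mulrDl mul1r.
Qed.

Lemma dvalN x : w (- x) = w x.
Proof.
have [->|x0] := eqVneq x 0; first by rewrite oppr0.
have n1 : (-1 : L) != 0 by rewrite oppr_eq0 oner_neq0.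
have := dvalM n1 n1; rewrite mulrNN mulr1 dval1 => w1.
by rewrite -mulN1r dvalM //; lia.
Qed.

(* [vge n x] reads "v(x) >= n" with the convention v(0) = +oo. *)
Definition vge n x := (x == 0) || (n <= w x).

Lemma vge_neq0 n x : x != 0 -> vge n x = (n <= w x).
Proof. by rewrite /vge => /negPf ->. Qed.

Lemma vge0 n : vge n 0. Proof. by rewrite /vge eqxx. Qed.

Lemma vgexx x : vge (w x) x. Proof. by rewrite /vge lexx orbT. Qed.

Lemma vgeW k n x : k <= n -> vge n x -> vge k x.
Proof.
by move=> kn /orP[/eqP->|nx]; rewrite /vge ?eqxx // (le_trans kn nx) orbT.
Qed.

Lemma vgeD n x y : vge n x -> vge n y -> vge n (x + y).
Proof.
move=> /orP[/eqP->|nx]; first by rewrite add0r.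
move=> /orP[/eqP->|ny]; first by rewrite addr0 /vge nx orbT.
have [->|x0] := eqVneq x 0; first by rewrite add0r /vge ny orbT.
have [->|y0] := eqVneq y 0; first by rewrite addr0 /vge nx orbT.
rewrite /vge; case: eqVneq => //= xy0; case: dw => _ h _.
by apply: le_trans (h _ _ x0 y0 xy0); rewrite le_min nx.
Qed.

Lemma vgeN n x : vge n (- x) = vge n x.
Proof. by rewrite /vge oppr_eq0 dvalN. Qed.

Lemma vgeB n x y : vge n x -> vge n y -> vge n (x - y).
Proof. by move=> nx ny; rewrite vgeD ?vgeN. Qed.

Lemma vgeM n k x y : vge n x -> vge k y -> vge (n + k) (x * y).
Proof.
have [->|x0] := eqVneq x 0; first by rewrite mul0r !vge0.
have [->|y0] := eqVneq y 0; first by rewrite mulr0 !vge0.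
by rewrite !vge_neq0 ?field_mulf_neq0 // dvalM //; lia.
Qed.

Lemma vgeX n x (k : nat) : 0 <= n -> vge n x -> vge (k%:Z * n) (x ^+ k).
Proof.
move=> n0 nx; elim: k => [|k IHk].
  by rewrite vge_neq0 ?oner_neq0 // dval1; lia.
by rewrite exprS intS mulrDl mul1r; exact: vgeM.
Qed.

Lemma vge_sum n (T : finType) (F : T -> L) :
  (forall i, vge n (F i)) -> vge n (\sum_i F i).
Proof. by move=> nF; apply: (big_ind (vge n)) => // *; rewrite ?vge0 ?vgeD. Qed.

(** The strictly smaller value wins: if [x + y] also had value above [w x], so would
    [x = (x + y) - y]. *)
Lemma dvalD_lt x y : x != 0 -> vge (w x + 1) y -> x + y != 0 /\ w (x + y) = w x.
Proof.
move=> x0 xy.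
have nvx : ~~ vge (w x + 1) x by rewrite vge_neq0 //; lia.
have nv : ~~ vge (w x + 1) (x + y).
  by apply: contra nvx => vxy; rewrite -[X in vge _ X](addrK y) vgeB.
have xy0 : x + y != 0 by apply: contra nv => /eqP->; exact: vge0.
have vy : vge (w x) y by apply: vgeW xy; lia.
by split=> //; move: nv (vgeD (vgexx x) vy); rewrite !vge_neq0 //; lia.
Qed.

(** If [w x < 0], then in [x^k = - sum_(i < k) a_i x^i] every term on the right has value at least
    [i * w x], which exceeds [k * w x]. *)
Lemma vge_integral (A : comNzRingType) (g : {rmorphism A -> L}) x :
  (forall a, vge 0 (g a)) -> integralOver g x -> vge 0 x.
Proof.
move=> g0 [p mon_p]; rewrite /root horner_coef size_map_poly_id0; last first.
  by rewrite (monicP mon_p) rmorph1 oner_neq0.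
have : (0 < size p)%N by rewrite size_poly_gt0 monic_neq0.
case Es : (size p) => [//|k] _ /eqP; rewrite big_ord_recr /= coef_map /=.
have -> : p`_k = 1 by rewrite -(monicP mon_p) lead_coefE Es.
rewrite rmorph1 mul1r => sum0; have [->|x0] := eqVneq x 0; first exact: vge0.
rewrite vge_neq0 // leNgt; apply/negP => wx.
have : vge (w (x ^+ k) + 1) (x ^+ k).
  have xk : x ^+ k = - \sum_(i < k) (map_poly g p)`_i * x ^+ i.
    by apply/eqP; rewrite -addr_eq0 addrC sum0.
  rewrite [X in vge _ X]xk vgeN; apply: vge_sum => i.
  rewrite coef_map -[_ + 1]add0r.
  apply: vgeM; first exact: g0.
  rewrite vge_neq0 ?field_expf_neq0 // !dvalX //.
  have ik := ltn_ord i.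
  (* The product form of [i * w x >= (k - 1) * w x], after which the bound [k * w x + 1] is
     linear. *)
  have : 0 <= (k%:Z - i%:Z - 1) * - w x by apply: mulr_ge0; lia.
  by rewrite mulrN !mulrBl mul1r; lia.
by rewrite vge_neq0 ?field_expf_neq0 //; lia.
Qed.

Lemma valuation_ringE : valuation_ring w = [set x | vge 0 x].
Proof.
apply/seteqP; split=> x; rewrite /valuation_ring /= => x_ge0.
  by have [->|x0] := eqVneq x 0; rewrite ?vge0 // vge_neq0 // x_ge0.
by move=> x0; rewrite -vge_neq0.
Qed.

Lemma dval_surj n : exists2 x, x != 0 & w x = n.
Proof. by case: dw. Qed.

End DiscreteValuation.

(** The ring determines the elements of value 0. For [p] with [w p = 1], the element [x * p^(- w x)]
    has value 0 for both valuations, so [w' x = w x * w' p]; surjectivity of [w'] then forces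
    [w' p = 1]. *)
Lemma valuation_unique (L : comUnitRingType) (w w' : L -> int) :
  (forall x : L, x != 0 -> x \is a GRing.unit) ->
  discrete_valuation w -> discrete_valuation w' ->
  valuation_ring w' = valuation_ring w -> forall x, x != 0 -> w' x = w x.
Proof.
move=> unitL dw dw' eqW.
have ge0 x : x != 0 -> (0 <= w' x) = (0 <= w x).
  move=> x0; have := congr1 (@^~ x) eqW => /= eqx.
  apply/idP/idP => x_ge0.
    have Wx : valuation_ring w x by rewrite -eqx.
    exact: Wx.
  have Wx : valuation_ring w' x by rewrite eqx.
  exact: Wx.
have eq0 x : x != 0 -> w x = 0 -> w' x = 0.
  move=> x0 wx; have := ge0 _ x0; have := ge0 _ (field_invr_neq0 unitL x0).
  by rewrite (dvalV unitL dw) // (dvalV unitL dw') // wx; lia.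
have [p p0 wp] := dval_surj dw 1.
(* Powers of [p] have natural exponents, hence [x * p^n] for [w x < 0] and [x / p^n] otherwise. *)
have powE x (n : nat) : x != 0 -> `|w x| = n%:Z ->
    w' x = w x * w' p.
  move=> x0 wxn; have pn0 := field_expf_neq0 unitL n p0.
  have wpn := dvalX unitL dw n p0; have wpn' := dvalX unitL dw' n p0.
  case: (ltP (w x) 0) => wx.
    have /eq0 := field_mulf_neq0 unitL x0 pn0.
    by rewrite (dvalM dw) // (dvalM dw') // wpn wpn' wp; nia.
  have pV0 := field_invr_neq0 unitL pn0.
  have /eq0 := field_mulf_neq0 unitL x0 pV0.
  by rewrite (dvalM dw) // (dvalM dw') // (dvalV unitL dw) //
    (dvalV unitL dw') // wpn wpn' wp; nia.
have mulE x : x != 0 -> w' x = w x * w' p.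
  by move=> x0; apply: (powE x `|w x|%N); rewrite ?abszE.
have wp'_ge0 : 0 <= w' p by rewrite ge0 // wp.
have [q q0 wq] := dval_surj dw' 1.
have := mulE q q0; rewrite wq => wpq.
have /esym/eqP := congr1 absz wpq; rewrite abszM muln_eq1 => /andP[_ /eqP wp'1].
have wp' : w' p = 1 by lia.
by move=> x x0; rewrite mulE // wp' mulr1.
Qed.

(** * Domains whose integral closure is a discrete valuation ring *)

Section ValuationDomain.
Variables (A : comNzRingType) (L : comUnitRingType) (f : {rmorphism A -> L}).
Variable w : L -> int.
Hypothesis fracL : is_fraction_field f.
Hypothesis closW : normalized_valuation_of (integral_closure f) w.

Let unitL : forall x : L, x != 0 -> x \is a GRing.unit.
Proof. by case: fracL. Qed.

Let dw : discrete_valuation w. Proof. by case: closW. Qed.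

Lemma integral_closure_vge x : integral_closure f x <-> vge w 0 x.
Proof. by case: closW => _ ->; rewrite valuation_ringE. Qed.

Lemma vge_im a : vge w 0 (f a).
Proof. exact/integral_closure_vge/integral_id. Qed.

Lemma im_neq0 a : (f a != 0) = (a != 0).
Proof. by case: fracL => _ fI _; rewrite -(inj_eq fI) rmorph0. Qed.

(* If z^-1 is a root of a monic p over A, then
   z^-1 = - (p_0 z^(k-1) + ... + p_(k-1)) is in A. *)
Lemma im_invertible a : f a != 0 -> w (f a) = 0 -> exists a', a * a' = 1.
Proof.
set z := f a => z0 wz.
have /integral_closure_vge[p mon_p] : vge w 0 z^-1.
  by rewrite /vge (dvalV unitL dw) // wz oppr0 lexx orbT.
rewrite /root horner_coef size_map_poly_id0; last first.
  by rewrite (monicP mon_p) rmorph1 oner_neq0.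
have p0 : (0 < size p)%N by rewrite size_poly_gt0 monic_neq0.
case Es : (size p) p0 => [//|k] _ /eqP.
rewrite big_ord_recr /= coef_map /=.
have -> : p`_k = 1 by rewrite -(monicP mon_p) lead_coefE Es.
rewrite rmorph1 mul1r.
(* A monic constant polynomial has no root; from here on the degree of [p] is [k.+1]. *)
case: k Es => [|k] Es.
  by rewrite big_ord0 add0r expr0 => /eqP; rewrite oner_eq0.
move=> sum0; exists (- \sum_(i < k.+1) p`_i * a ^+ (k - i)).
have [_ fI _] := fracL; apply: fI; rewrite rmorphM rmorphN rmorph_sum rmorph1.
suff -> : - (\sum_(i < k.+1) f (p`_i * a ^+ (k - i))) = z^-1.
  by rewrite divrr // unitL.
apply/eqP; rewrite eq_sym -addr_eq0; apply/eqP.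
transitivity (z ^+ k * (\sum_(i < k.+1) f p`_i * z^-1 ^+ i + z^-1 ^+ k.+1)).
  rewrite mulrDr addrC mulr_sumr; congr (_ + _).
    apply: eq_bigr => i _; rewrite rmorphM rmorphXn -/z mulrCA; congr (_ * _).
    have ik : (i <= k)%N by rewrite -ltnS.
    have -> : z ^+ k = z ^+ (k - i) * z ^+ i by rewrite -exprD subnK.
    by rewrite -mulrA -exprMn divrr ?unitL // expr1n mulr1.
  by rewrite exprS mulrCA -exprMn divrr ?unitL // expr1n mulr1.
rewrite (_ : _ + _ = 0) ?mulr0 // -[RHS]sum0; congr (_ + _).
by apply: eq_bigr => i _; rewrite coef_map.
Qed.

(** The contraction to [A] of the maximal ideal of the valuation ring; it turns out to be the unique
    maximal ideal of [A]. *)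
Definition val_pos : set A := [set a | vge w 1 (f a)].

Lemma val_pos_ideal : is_ideal val_pos.
Proof.
split=> // [|x y|a x _]; rewrite /val_pos /=.
- by rewrite rmorph0 vge0.
- by rewrite rmorphD; exact: vgeD.
- by rewrite rmorphM -[1]add0r; apply: vgeM => //; exact: vge_im.
Qed.

Lemma val_pos1 : ~ val_pos 1.
Proof. by rewrite /val_pos /= rmorph1 vge_neq0 ?oner_neq0 // (dval1 dw). Qed.

(** An element of [A] outside [val_pos] has value 0 and is therefore invertible in [A]. *)
Lemma proper_ideal_val_pos J : is_ideal J -> ~ J 1 -> J `<=` val_pos.
Proof.
case=> _ J0 JD JM J1 a Ja; apply: contrapT; rewrite /val_pos /= /vge.
move=> /negP; rewrite negb_or -ltNge => /andP[a0 wa].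
have := vge_im a; rewrite vge_neq0 // => wa'.
have [a' aa'] : exists a', a * a' = 1 by apply: im_invertible => //; lia.
by apply: J1; rewrite -aa' mulrC; apply: JM.
Qed.

Lemma maximal_val_pos : maximal_ideal_of [set: A] val_pos.
Proof.
split; [exact: val_pos_ideal|exact: val_pos1|move=> J Ji J1 sJ].
by apply/seteqP; split=> //; exact: proper_ideal_val_pos.
Qed.

Lemma maximal_idealE N : maximal_ideal_of [set: A] N -> N = val_pos.
Proof.
case=> Ni N1 /(_ _ val_pos_ideal val_pos1) -> //.
exact: proper_ideal_val_pos.
Qed.

Lemma valuation_domain_local : is_local A.
Proof.
exists val_pos; split=> [|N /maximal_idealE //]; exact: maximal_val_pos.
Qed.

Lemma vge1_maximal : maximal_ideal_of (integral_closure f) [set x | vge w 1 x].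
Proof.
split.
- split=> [x /=|||] /=.
  + by move=> x1; apply/integral_closure_vge; apply: vgeW x1.
  + by rewrite vge0.
  + by move=> x y; exact: vgeD.
  + move=> a x /integral_closure_vge a0 x1.
    by rewrite -[1]add0r; apply: vgeM.
- by rewrite /= vge_neq0 ?oner_neq0 // (dval1 dw).
move=> J [JW J0 JD JM] J1 sJ; apply/seteqP; split=> //= x Jx.
have [->|x0] := eqVneq x 0; first exact: vge0.
rewrite /= vge_neq0 // leNgt; apply/negP => wx.
have /integral_closure_vge := JW _ Jx; rewrite vge_neq0 // => wx'.
apply: J1; rewrite -(mulVr (unitL x0)); apply: JM => //.
apply/integral_closure_vge; rewrite /vge (dvalV unitL dw) //.
by apply/orP; right; lia.
Qed.

Lemma maximal_closureE M :
  maximal_ideal_of (integral_closure f) M -> M = [set x | vge w 1 x].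
Proof.
case=> -[MW M0 MD MM] M1 Mmax; have [Wi W1 _] := vge1_maximal.
apply/esym; apply: Mmax => // x Mx /=.
have [->|x0] := eqVneq x 0; first exact: vge0.
rewrite /= vge_neq0 // leNgt; apply/negP => wx.
have /integral_closure_vge := MW _ Mx; rewrite vge_neq0 // => wx'.
apply: M1; rewrite -(mulVr (unitL x0)); apply: MM => //.
apply/integral_closure_vge; rewrite /vge (dvalV unitL dw) //.
by apply/orP; right; lia.
Qed.

(** Both maximal ideals are unique, and [val_pos] is by definition the preimage of the upper one, so
    only surjectivity of the residue map remains. *)
Lemma residually_rationalE :
  residually_rational f <->
  forall x, vge w 0 x -> exists a, vge w 1 (x - f a).
Proof.
split=> [rr x x0|rr N M /maximal_idealE -> /maximal_closureE ->].
  have [_ rr'] := rr _ _ maximal_val_pos vge1_maximal.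
  by apply: rr'; apply/integral_closure_vge.
by split=> // x /integral_closure_vge; exact: rr.
Qed.

(** If [a / s] has value 1, then [w (f a) = 1 + w (f s)], which is positive. *)
Lemma exists_val_pos : exists2 a, a != 0 & 0 < w (f a).
Proof.
have [x x0 wx] := dval_surj dw 1.
have [_ _ /(_ x) [a [s [s0 Ex]]]] := fracL.
have fs0 : f s != 0 by rewrite im_neq0.
have a0 : f a != 0 by apply: contra_neq x0 => a0; rewrite Ex a0 mul0r.
move: wx; rewrite Ex (dvalM dw) ?field_invr_neq0 // (dvalV unitL dw) // => wx.
have := vge_im s; rewrite vge_neq0 // => ws.
by exists a; [rewrite -im_neq0|lia].
Qed.

(** The product [d] of the denominators of finitely many generators multiplies the whole closure
    into [A], and an element of value at least [w (f d)] is [f d] times an integral one. *)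
Lemma integral_closure_conductor : fin_gen f (integral_closure f) ->
  exists2 d, d != 0 & forall x, vge w (w (f d)) x -> exists a, x = f a.
Proof.
case=> n [g Wg]; have [_ _ frac] := fracL.
have [a ag] := choice (fun i => frac (g i)).
have [s sag] := choice ag.
have s0 i : f (s i) != 0 by rewrite im_neq0; case: (sag i).
pose d := \prod_i s i.
have d0 : f d != 0.
  rewrite rmorph_prod; apply: (big_ind (fun x => x != 0)) => //.
    exact: oner_neq0.
  exact: field_mulf_neq0.
exists d; first by rewrite -im_neq0.
move=> x xd; have : vge w 0 (x / f d).
  have [->|x0] := eqVneq x 0; first by rewrite mul0r vge0.
  have dV0 := field_invr_neq0 unitL d0.
  rewrite vge_neq0 ?field_mulf_neq0 // (dvalM dw) // (dvalV unitL dw) //.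
  by move: xd; rewrite vge_neq0 //; lia.
move=> /integral_closure_vge; rewrite Wg => -[c Ex].
exists (\sum_i c i * (a i * \prod_(j | j != i) s j)).
rewrite -[LHS](divrK (unitL d0)) Ex mulr_suml rmorph_sum.
apply: eq_bigr => i _; rewrite !rmorphM -mulrA; congr (_ * _).
have [_ ->] := sag i; rewrite /d (bigD1 i) //= rmorphM.
by rewrite mulrA divrK // unitL.
Qed.

(** For [z] of positive value, a high power [z^k] has [z^k / p] in the conductor, so [z^k] lies in
    [A p], hence in [P], and [z] lies in [P] by primality. *)
Lemma nonzero_primeE P : fin_gen f (integral_closure f) ->
  prime_ideal P -> (exists2 p, P p & p != 0) -> P = val_pos.
Proof.
move=> /integral_closure_conductor[d d0 dA] [Pi P1 PP] [p Pp p0].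
have [_ P0 _ PM] := Pi.
apply/seteqP; split; first exact: proper_ideal_val_pos.
have PX z (n : nat) : P (z ^+ n) -> P z.
  by elim: n => [/P1 //|n IHn]; rewrite exprS => /PP[//|/IHn].
have fp0 : f p != 0 by rewrite im_neq0.
have pV0 := field_invr_neq0 unitL fp0.
move=> z z1; pose k := absz (w (f p) + w (f d)); apply: (PX _ k).
have wp := vge_im p; rewrite vge_neq0 // in wp.
have wd := vge_im d; rewrite vge_neq0 ?im_neq0 // in wd.
have [|a Ea] := dA (f (z ^+ k) / f p).
  have -> : w (f d) = k%:Z * 1 + - w (f p) by rewrite /k; lia.
  apply: vgeM => //; last by rewrite vge_neq0 // (dvalV unitL dw).
  by rewrite rmorphXn; apply: vgeX.
have -> : z ^+ k = a * p; last by apply: PM.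
have [_ fI _] := fracL; apply: fI; rewrite rmorphM -Ea.
by rewrite divrK // unitL.
Qed.

Lemma valuation_domain_integral : GRing.integral_domain_axiom A.
Proof.
move=> x y xy0; apply/negPn/negP; rewrite negb_or -!im_neq0 => /andP[x0 y0].
by have := field_mulf_neq0 unitL x0 y0; rewrite -rmorphM xy0 rmorph0 eqxx.
Qed.

Lemma valuation_domain_krull_dim :
  fin_gen f (integral_closure f) -> has_krull_dim A 1.
Proof.
move=> fgW; split.
  exists (fun i : 'I_2 => if i == ord0 then [set 0] else val_pos); split.
    move=> i; case: ifP => _.
      split=> [||x y]; last 1 first.
      - by move=> /= /valuation_domain_integral /orP[] /eqP; [left|right].
      - split=> //= [x y -> ->|a x _ ->]; [exact: addr0|exact: mulr0].
      - by move=> /= /eqP; rewrite oner_eq0.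
    split; [exact: val_pos_ideal|exact: val_pos1|move=> x y].
    rewrite /val_pos /= rmorphM => xy; apply: contrapT => /not_orP[].
    rewrite /vge => /negP; rewrite negb_or => /andP[x0 wx].
    move=> /negP; rewrite negb_or => /andP[y0 wy].
    by move: xy; rewrite vge_neq0 ?field_mulf_neq0 // (dvalM dw) //; lia.
  move=> [[|[|//]] //= i2] [[|[|//]] //= j2] _.
  split=> [x ->|]; first by case: val_pos_ideal.
  have [a a0 wa] := exists_val_pos => sub0.
  have /sub0/eqP : val_pos a by rewrite /val_pos /= vge_neq0 ?im_neq0.
  by rewrite (negPf a0).
move=> [P [Pp Plt]].
(* A prime strictly above another is nonzero, so the two upper primes of the chain both equal
   [val_pos], against strict inclusion. *)
have nz (i j : 'I_3) : (i < j)%N -> P j = val_pos.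
  move=> /Plt[_] Pij; apply: nonzero_primeE => //.
  apply: contrapT => noP; apply: Pij => x Px.
  have [->|x0] := eqVneq x 0; first by have [[]] := Pp i.
  by case: noP; exists x.
have [_] := Plt (inord 1) (inord 2) (ltac:(by rewrite !inordK)).
by rewrite !(nz ord0) ?inordK //; apply.
Qed.

Lemma valuation_domain_1dim :
  noetherian A -> fin_gen f (integral_closure f) ->
  noetherian_1dim_local_domain A.
Proof.
move=> nA fgW; split=> //; first exact: valuation_domain_integral.
  exact: valuation_domain_krull_dim.
exact: valuation_domain_local.
Qed.

End ValuationDomain.

(** * The quadratic extension by a square root of b *)

(** Locked so that computations go through the coordinate rules below; [quad.unlock] is the only way
    back to the quotient ring. *)
HB.lock Definition quad (R : idomainType) (b : R) (x y : {fraction R}) :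
  frac_alpha b := frac_to_alpha b x + frac_to_alpha b y * alpha b.

Section QuadraticExtension.
Variables (R : idomainType) (b : R).
Local Notation K := {fraction R}.
Local Notation L := (frac_alpha b).
Local Notation C := (frac_to_alpha b).
Local Notation B := (tofrac b).
Implicit Types (x y : K) (z : L).

HB.instance Definition _ := GRing.RMorphism.copy C (qpolyC (t2b_frac b)).

Local Notation quad := (quad b).

Lemma size_t2b : size (mk_monic (t2b_frac b)) = 3.
Proof. by rewrite mk_monic_t2b size_XnsubC. Qed.

Lemma alpha_polyE : alpha b = 'X :> {poly K}.
Proof. by rewrite /alpha qpolyXE ?size_XnsubC ?monicXnsubC. Qed.

Lemma quad_polyE x y : quad x y = x%:P + y *: 'X :> {poly K}.
Proof.
rewrite !quad.unlock poly_of_qpolyD poly_of_qpolyM alpha_polyE /=.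
rewrite Pdiv.CommonRing.rmodp_small; first by rewrite mul_polyC.
rewrite size_t2b mul_polyC; apply: leq_ltn_trans (size_scale_leq _ _) _.
by rewrite size_polyX.
Qed.

Lemma alpha_sq : alpha b * alpha b = C B.
Proof.
apply: val_inj; rewrite [LHS]poly_of_qpolyM alpha_polyE.
rewrite [X in Pdiv.CommonRing.rmodp _ X]mk_monic_t2b.
(* This displays the division of [X^2] by [X^2 - b], with quotient 1 and remainder [b]. *)
rewrite (_ : 'X * 'X = 1 * t2b_frac b + B%:P); last first.
  by rewrite mul1r subrK expr2.
rewrite Pdiv.RingMonic.rmodp_addl_mul_small ?monicXnsubC // size_XnsubC //.
by rewrite ltnS (leq_trans (size_polyC_leq1 _)).
Qed.

Definition quad_re z : K := (z : {poly K})`_0.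
Definition quad_im z : K := (z : {poly K})`_1.

Lemma re_quad x y : quad_re (quad x y) = x.
Proof. by rewrite /quad_re quad_polyE coefD coefC coefZ coefX mulr0 addr0. Qed.

Lemma im_quad x y : quad_im (quad x y) = y.
Proof. by rewrite /quad_im quad_polyE coefD coefC coefZ coefX mulr1 add0r. Qed.

Lemma quad_reim z : z = quad (quad_re z) (quad_im z).
Proof.
apply: val_inj; rewrite [RHS]quad_polyE; apply/polyP => i.
rewrite coefD coefC coefZ coefX; case: i => [|[|i]] /=.
- by rewrite mulr0 addr0.
- by rewrite mulr1 add0r.
rewrite mulr0 addr0 nth_default // -ltnS; apply: leq_trans (size_mk_monic z) _.
by rewrite size_t2b.
Qed.

Lemma quadP z : exists x y, z = quad x y.
Proof. by exists (quad_re z), (quad_im z); exact: quad_reim. Qed.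

Lemma quad_inj x y x' y' : quad x y = quad x' y' -> x = x' /\ y = y'.
Proof.
move=> E; have := congr1 (@quad_re) E; have := congr1 (@quad_im) E.
by rewrite !re_quad !im_quad => -> ->.
Qed.

Lemma quad0 : quad 0 0 = 0.
Proof. by rewrite !quad.unlock rmorph0 mul0r addr0. Qed.

Lemma quad_eq0 x y : (quad x y == 0) = (x == 0) && (y == 0).
Proof.
apply/eqP/andP => [|[/eqP-> /eqP->]]; last exact: quad0.
by rewrite -quad0 => /quad_inj[-> ->].
Qed.

Lemma quadD x y x' y' : quad x y + quad x' y' = quad (x + x') (y + y').
Proof. by rewrite !quad.unlock !rmorphD mulrDl addrACA. Qed.

Lemma quadB x y x' y' : quad x y - quad x' y' = quad (x - x') (y - y').
Proof. by rewrite !quad.unlock !rmorphB /=; ring. Qed.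

Lemma quadM x y x' y' :
  quad x y * quad x' y' = quad (x * x' + B * (y * y')) (x * y' + x' * y).
Proof.
rewrite !quad.unlock !rmorphD !rmorphM /= -alpha_sq; ring.
Qed.

Lemma quadC x : quad x 0 = C x.
Proof. by rewrite !quad.unlock rmorph0 mul0r addr0. Qed.

Lemma quad_alpha : quad 0 1 = alpha b.
Proof. by rewrite !quad.unlock rmorph0 rmorph1 mul1r add0r. Qed.

Definition quad_norm z : K := quad_re z ^+ 2 - B * quad_im z ^+ 2.

Lemma norm_quad x y : quad_norm (quad x y) = x ^+ 2 - B * y ^+ 2.
Proof. by rewrite /quad_norm re_quad im_quad. Qed.

Lemma quad_normM z z' : quad_norm (z * z') = quad_norm z * quad_norm z'.
Proof.
have [x [y ->]] := quadP z; have [x' [y' ->]] := quadP z'.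
by rewrite quadM !norm_quad; ring.
Qed.

Lemma quad_conj x y : quad x y * quad x (- y) = C (quad_norm (quad x y)).
Proof. by rewrite quadM norm_quad -quadC; congr quad; ring. Qed.

End QuadraticExtension.

(** * The valuation given by the norm *)

Section QuadraticValuation.

Variables (R : idomainType) (b : R) (v : {fraction R} -> int) (k : int).
Local Notation K := {fraction R}.
Local Notation L := (frac_alpha b).
Local Notation C := (frac_to_alpha b).
Local Notation B := (tofrac b).
Local Notation quad := (quad b).
Hypothesis dv : discrete_valuation v.
Hypothesis b0 : b != 0.
Hypothesis vb : v B = 2 * k + 1.

Let unitK (x : K) : x != 0 -> x \is a GRing.unit.
Proof. by rewrite unitfE. Qed.

Definition quad_val (z : L) : int := v (quad_norm z).

(** The two terms of the norm have values of different parity, so they cannot cancel. The minimum is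
    expressed through its lower bounds [n], so that a zero coordinate simply drops out. *)
Lemma norm_quad_val (x y : K) : quad x y != 0 :> L ->
  quad_norm (quad x y : L) != 0 /\
  forall n : int, (n <= quad_val (quad x y)) =
    ((x == 0) || (n <= 2 * v x)) && ((y == 0) || (n <= 2 * v y + (2 * k + 1))).
Proof.
have B0 : B != 0 by rewrite tofrac_eq0.
rewrite /quad_val norm_quad quad_eq0 => xy0.
have vx2 : x != 0 -> x ^+ 2 != 0 /\ v (x ^+ 2) = 2 * v x.
  by move=> x0; rewrite expf_neq0 // (dvalX unitK dv).
have vy2 : y != 0 ->
    - (B * y ^+ 2) != 0 /\ v (- (B * y ^+ 2)) = 2 * v y + (2 * k + 1).
  move=> y0; rewrite oppr_eq0 mulf_neq0 ?expf_neq0 //; split=> //.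
  by rewrite (dvalN dv) (dvalM dv) ?expf_neq0 // (dvalX unitK dv) // vb; lia.
have [x0|x0] := eqVneq x 0.
  rewrite x0 eqxx /= in xy0 *; rewrite expr0n /= add0r (negPf xy0) /=.
  by have [? ->] := vy2 xy0.
have [x20 {}vx2] := vx2 x0.
have [y0|y0] := eqVneq y 0.
  by rewrite y0 expr0n /= mulr0 subr0 vx2; split=> // n; rewrite andbT.
have [y20 {}vy2] := vy2 y0.
(* Parity makes the second case strict as well, so [dvalD_lt] applies in both. *)
have [lt_xy|le_yx] := ltP (v (x ^+ 2)) (v (- (B * y ^+ 2))).
  have [|xy20 vxy] := @dvalD_lt _ _ dv (x ^+ 2) (- (B * y ^+ 2)) x20.
    by rewrite vge_neq0 //; lia.
  by rewrite vxy; split=> // n /=; lia.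
have [|xy20 vxy] := @dvalD_lt _ _ dv (- (B * y ^+ 2)) (x ^+ 2) y20.
  by rewrite vge_neq0 //; lia.
by rewrite [x ^+ 2 - _]addrC vxy; split=> // n /=; lia.
Qed.

Lemma quad_norm_neq0 (z : L) : z != 0 -> quad_norm z != 0.
Proof. by have [x [y ->]] := quadP z => /norm_quad_val[]. Qed.

(** A nonzero element divides its norm, which is a nonzero element of the base field. *)
Lemma quad_unit (z : L) : z != 0 -> z \is a GRing.unit.
Proof.
move=> /quad_norm_neq0; have [x [y ->]] := quadP z => n0.
have : C (quad_norm (quad x y)) \is a GRing.unit := rmorph_unit C (unitK n0).
by rewrite -quad_conj unitrM => /andP[].
Qed.

Lemma vge_quad n (x y : K) : vge quad_val n (quad x y) =
  ((x == 0) || (n <= 2 * v x)) && ((y == 0) || (n <= 2 * v y + (2 * k + 1))).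
Proof.
have [xy0|xy0] := eqVneq (quad x y : L) 0.
  by rewrite /vge xy0 eqxx; move/eqP: xy0; rewrite quad_eq0 => /andP[-> ->].
by rewrite vge_neq0 //; have [_ ->] := norm_quad_val xy0.
Qed.

Lemma quad_val_neq0 (x y : K) : quad x y != 0 :> L ->
  (x != 0 /\ quad_val (quad x y) = 2 * v x) \/
  (y != 0 /\ quad_val (quad x y) = 2 * v y + (2 * k + 1)).
Proof.
move=> xy0; have [_ vE] := norm_quad_val xy0; move: xy0; rewrite quad_eq0.
(* The exact value is the bound that holds at [n] and fails at [n + 1]. *)
have := vE (quad_val (quad x y)); have := vE (quad_val (quad x y) + 1).
move: (quad_val _) => n; case: eqP => _; case: eqP => _ //= h1 h2 _.
- by right; split=> //; lia.
- by left; split=> //; lia.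
by have [?|?] := leP (2 * v x) (2 * v y + (2 * k + 1)); [left|right];
  split=> //; lia.
Qed.

(** The ultrametric inequality on one coordinate: [d] is 0 for the rational part and [2 * k + 1] for
    the part along [alpha]. *)
Lemma vge_dblD (d n : int) (x y : K) : (x == 0) || (n <= 2 * v x + d) ->
  (y == 0) || (n <= 2 * v y + d) -> (x + y == 0) || (n <= 2 * v (x + y) + d).
Proof.
have [-> _|x0 /= nx] := eqVneq x 0; first by rewrite add0r.
have [-> _|y0 /= ny] := eqVneq y 0; first by rewrite addr0 nx orbT.
have [//|xy0 /=] := eqVneq (x + y) 0.
have : Num.min (v x) (v y) <= v (x + y) by case: dv => _ h _; exact: h.
by rewrite ge_min => /orP[]; lia.
Qed.

Lemma quad_discrete_valuation : discrete_valuation quad_val.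
Proof.
split=> [z z' z0 z'0|z z' z0 z'0|n].
- by rewrite /quad_val quad_normM (dvalM dv) ?quad_norm_neq0.
- set n := Num.min _ _ => zz'0; rewrite -vge_neq0 //.
  have : vge quad_val n z by rewrite vge_neq0 // ge_min lexx.
  have : vge quad_val n z' by rewrite vge_neq0 // ge_min lexx orbT.
  have [x [y ->]] := quadP z; have [x' [y' ->]] := quadP z'.
  rewrite quadD !vge_quad => /andP[nx' ny'] /andP[nx ny].
  apply/andP; split; last exact: vge_dblD.
  by rewrite -[2 * _]addr0; apply: vge_dblD; rewrite addr0.
have xE (x : K) : x != 0 -> quad x 0 != 0 :> L by rewrite quad_eq0 eqxx andbT.
have yE (x : K) : x != 0 -> quad 0 x != 0 :> L by rewrite quad_eq0 eqxx.
(* Even values are reached by elements of the base field, odd ones by its multiples of [alpha]. *)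
have [/eqP n2|n2] := boolP ((n %% 2)%Z == 0).
  have [x x0 vx] := dval_surj dv (n %/ 2)%Z.
  exists (quad x 0); first exact: xE.
  by have [[_ ->]|[]] := quad_val_neq0 (xE _ x0); rewrite ?eqxx //; lia.
have [y y0 vy] := dval_surj dv ((n - (2 * k + 1)) %/ 2)%Z.
exists (quad 0 y); first exact: yE.
by have [[]|[_ ->]] := quad_val_neq0 (yE _ y0); rewrite ?eqxx //; lia.
Qed.

End QuadraticValuation.

(** * The quotient of the Rees algebra *)

Section FiniteGeneration.
Variables (A K : comNzRingType) (f : {rmorphism A -> K}).

(** Concatenates two generating families, one for each coordinate in the applications. *)
Lemma fin_gen2 (M : set K) (n p : nat) (g : 'I_n -> K) (h : 'I_p -> K) :
  (forall x, M x <-> exists (c : 'I_n -> A) (d : 'I_p -> A),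
     x = \sum_i f (c i) * g i + \sum_j f (d j) * h j) ->
  fin_gen f M.
Proof.
move=> ME.
pose glue T (u : 'I_n -> T) (w : 'I_p -> T) (i : 'I_(n + p)) :=
  match split i with inl j => u j | inr j => w j end.
have glueL T u w i : @glue T u w (lshift p i) = u i.
  by rewrite /glue -[lshift p i]/(unsplit (inl i)) unsplitK.
have glueR T u w i : @glue T u w (rshift n i) = w i.
  by rewrite /glue -[rshift n i]/(unsplit (inr i)) unsplitK.
exists (n + p)%N, (glue _ g h); apply/seteqP; split=> x /=.
  move=> /ME[c [d ->]]; exists (glue _ c d); rewrite big_split_ord /=.
  by congr (_ + _); apply: eq_bigr => i _; rewrite ?glueL ?glueR.
move=> [c ->]; apply/ME; exists (c \o lshift p), (c \o @rshift n p).
rewrite big_split_ord /=.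
by congr (_ + _); apply: eq_bigr => i _; rewrite ?glueL ?glueR.
Qed.

Lemma fin_gen_mem (M : set K) (n : nat) (g : 'I_n -> K) i :
  M = [set x | exists c : 'I_n -> A, x = \sum_i f (c i) * g i] -> M (g i).
Proof.
move=> ->; exists (fun j => (j == i)%:R); rewrite (bigD1 i) //= eqxx rmorph1.
rewrite mul1r big1 ?addr0 // => j /negPf ->; by rewrite rmorph0 mul0r.
Qed.

End FiniteGeneration.

Lemma ideal_sum (A : comNzRingType) (B J : set A) (T : finType) (F : T -> A) :
  ideal_of B J -> (forall i, J (F i)) -> J (\sum_i F i).
Proof. by move=> [_ J0 JD _] JF; apply: (big_ind J). Qed.

Lemma fraction_exists (R : idomainType) (x : {fraction R}) :
  exists a s : R, s != 0 /\ x = tofrac a / tofrac s.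
Proof.
elim/quotW: x => r; exists \n_r, \d_r; split; first exact: denom_ratioP.
have d0 : tofrac \d_r != 0 by rewrite tofrac_eq0 denom_ratioP.
apply: (mulIf d0); rewrite divfK //.
(* On representatives, equality of fractions becomes equality of cross products. *)
unlock tofrac; rewrite -[LHS]FracField.pi_mul.
apply/eqP; rewrite FracField.equivf_def /FracField.mulf.
by rewrite !numden_Ratio ?mulf_neq0 ?oner_neq0 ?denom_ratioP // !mulr1 mulrC.
Qed.

Lemma tofrac_is_fraction_field (R : idomainType) :
  is_fraction_field (@tofrac R).
Proof.
split=> [x|x y /eqP|x]; first by rewrite unitfE.
  by rewrite tofrac_eq => /eqP.
exact: fraction_exists.
Qed.

(** * The embedding and its image [R + I alpha] *)

Section ReesQuotient.
Variables (R : idomainType) (b : R) (I : set R).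
Hypothesis idealI : is_ideal I.
Local Notation K := {fraction R}.
Local Notation L := (frac_alpha b).
Local Notation C := (frac_to_alpha b).
Local Notation B := (tofrac b).
Local Notation quad := (quad b).
Local Notation emb := (@rees_quot_embed R b I).

Lemma ideal_powS_sub n : ideal_pow I n.+1 `<=` I.
Proof.
move=> x [k [a [c [Ia _ ->]]]]; apply: ideal_sum (idealI) _ => i.
by case: idealI => _ _ _ h; rewrite mulrC; apply: h.
Qed.

(** Even powers of [alpha] lie in [R]. An odd power [i] contributes to the coordinate along [alpha],
    with a coefficient in [I^i], which is inside [I] because [i] is positive. *)
Lemma rees_eval_quad (p : rees_algebra I) :
  exists x y : R, I y /\ rees_eval b p = quad (tofrac x) (tofrac y).
Proof.
have [_ I0 ID IM] := idealI.
have /asboolP pI := valP p; rewrite /rees_eval.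
have Cin c : in_qpoly (t2b_frac b) (tofrac c)%:P = C (tofrac c).
  apply: val_inj; rewrite [LHS]in_qpoly_small // size_t2b ltnS.
  by rewrite (leq_trans (size_polyC_leq1 _)).
rewrite -[X in map_poly _ X]coefK poly_def !rmorph_sum /=.
apply: (big_ind (fun z : L =>
  exists x y : R, I y /\ z = quad (tofrac x) (tofrac y))).
- by exists 0, 0; split=> //; rewrite rmorph0 quad0.
- move=> _ _ [x [y [Iy ->]]] [x' [y' [Iy' ->]]]; exists (x + x'), (y + y').
  by split; [exact: ID|rewrite quadD -!rmorphD].
move=> i _; rewrite -mul_polyC !rmorphM !rmorphXn /= map_polyC map_polyX /= Cin.
rewrite -/(alpha b).
have sqX j : alpha b ^+ (j * 2) = C (tofrac (b ^+ j)).
  by rewrite mulnC exprM expr2 alpha_sq !rmorphXn.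
have -> : alpha b ^+ i = C (tofrac (b ^+ (i %/ 2))) * alpha b ^+ odd i.
  by rewrite {1}(divn_eq i 2) modn2 exprD sqX.
case: (boolP (odd i)) => oi.
  exists 0, (b ^+ (i %/ 2) * p`_i); split.
    apply: IM => //; have : (0 < i)%N by case: (nat_of_ord i) oi.
    by have := pI i; case: (nat_of_ord i) => // n /ideal_powS_sub.
  by rewrite quad.unlock !rmorph0 add0r !rmorphM mulrCA mulrA.
exists (p`_i * b ^+ (i %/ 2)), 0; split=> //.
by rewrite mulr1 rmorph0 quadC -!rmorphM.
Qed.

Lemma rees_embed_quad a :
  exists x y : R, I y /\ emb a = quad (tofrac x) (tofrac y).
Proof. by rewrite -[a]reprK rees_quot_embed_pi; exact: rees_eval_quad. Qed.

Lemma rees_embed_lift (x y : R) : I y ->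
  exists a, emb a = quad (tofrac x) (tofrac y).
Proof.
move=> Iy; pose p := x%:P + y *: 'X.
have pI : p \in rees I.
  apply/asboolP => n; rewrite coefD coefC coefZ coefX.
  case: n => [|[|n]] //=; last by rewrite mulr0 addr0; exact: ideal_mul0.
  (* [ideal_pow I 1] is [I] times the unit ideal, so [y] is the one-term sum [y * 1]. *)
  exists 1%N, (fun=> y), (fun=> 1); split=> //.
  by rewrite big_ord1 mulr1 add0r.
exists (\pi_(rees_quot b I) (ReesAlgebra pI)); rewrite rees_quot_embed_pi.
have pE : map_poly (@tofrac R) p = (tofrac x)%:P + tofrac y *: 'X.
  by rewrite rmorphD /= map_polyC map_polyZ map_polyX.
apply: val_inj; rewrite [RHS]quad_polyE [LHS]in_qpoly_small //= pE size_t2b.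
rewrite ltnS (leq_trans (size_polyD _ _)) // geq_max.
rewrite (leq_trans (size_polyC_leq1 _)) //=.
by rewrite (leq_trans (size_scale_leq _ _)) // size_polyX.
Qed.

(** The polynomial [t^2 - b] is monic, so division by it is possible over [R]. The remainder of an
    element of the kernel represents 0 in degree below 2, hence vanishes, and the quotient is in
    [R[t]] as [rees_rel] requires. *)
Lemma rees_embed_inj : injective emb.
Proof.
apply: raddf_inj => a a0.
have : rees_eval b (repr a) = 0 by rewrite -rees_quot_embed_pi reprK.
rewrite -[in a = 0](reprK a); set p := repr a => p0.
rewrite -[RHS](rmorph0 \pi_(rees_quot b I)).
apply/eqP; rewrite -Quotient.idealrBE subr0; apply/asboolP.
set h := 'X^2 - b%:P; have mh : h \is monic by exact: monicXnsubC.
exists (Pdiv.CommonRing.rdivp (rees_val p) h).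
rewrite {1}(Pdiv.RingMonic.rdivp_eq mh (rees_val p)).
suff -> : Pdiv.CommonRing.rmodp (rees_val p) h = 0 by rewrite addr0.
set r := Pdiv.CommonRing.rmodp _ _.
have sr : (size r < 3)%N.
  rewrite -[3%N](size_XnsubC b (isT : (0 < 2)%N)).
  by rewrite Pdiv.CommonRing.ltn_rmodp monic_neq0.
have {p0} : rees_eval b p = 0 :> {poly K} by rewrite p0.
rewrite /= [X in Pdiv.CommonRing.rmodp _ X]mk_monic_t2b.
rewrite (Pdiv.RingMonic.rdivp_eq mh (rees_val p)) -/r rmorphD rmorphM /=.
have -> : map_poly (@tofrac R) h = t2b_frac b.
  by rewrite rmorphB /= map_polyXn map_polyC.
rewrite Pdiv.RingMonic.rmodp_addl_mul_small ?monicXnsubC //; last first.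
  by rewrite size_XnsubC // size_map_inj_poly // => x y /eqP;
    rewrite tofrac_eq => /eqP.
move=> r0; apply/polyP => i; apply/eqP.
by rewrite coef0 -tofrac_eq0 -coef_map /= r0 coef0.
Qed.

End ReesQuotient.

(** * The Noetherian property, through coordinates *)

Section ReesNoetherian.
Variables (R : idomainType) (b : R) (I : set R).
Hypothesis idealI : is_ideal I.
Local Notation L := (frac_alpha b).
Local Notation quad := (quad b).
Local Notation emb := (@rees_quot_embed R b I).

(* An ideal J of R + I alpha is spanned by generators of J \cap R and by lifts
   of generators of the ideal of alpha-coordinates of J. *)
Lemma rees_quot_noetherian : noetherian R -> noetherian (rees_quot b I).
Proof.
move=> nR J iJ; have [_ J0 JD JM] := iJ.
have [re re_im] := choice (@rees_embed_quad R b I idealI).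
have [im embE] := choice re_im.
have tI (x y : R) : tofrac x = tofrac y -> x = y.
  by move/eqP; rewrite tofrac_eq => /eqP.
have quadI (x y x' y' : R) :
    quad (tofrac x) (tofrac y) = quad (tofrac x') (tofrac y') ->
    x = x' /\ y = y'.
  by case/quad_inj => /tI-> /tI->.
have coordD a c : re (a + c) = re a + re c /\ im (a + c) = im a + im c.
  apply: quadI; rewrite -(embE _).2 !rmorphD -quadD /=.
  by rewrite -(embE a).2 -(embE c).2.
have coord0 : re 0 = 0 /\ im 0 = 0.
  by apply: quadI; rewrite -(embE _).2 !rmorph0 quad0.
have coordN a : re (- a) = - re a /\ im (- a) = - im a.
  apply: quadI; rewrite -(embE _).2 !rmorphN /= (embE a).2.
  by rewrite !quad.unlock !rmorphN mulNr opprD.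
have coord_inj a c : re a = re c -> im a = im c -> a = c.
  by move=> Er Ei; apply: (rees_embed_inj (b := b)); rewrite !(embE _).2 Er Ei.
have [_ I0 _ _] := idealI.
(* [iota] embeds [R] as the elements with zero coordinate along [alpha]; multiplication by [iota r]
   makes both coordinates [R]-linear. *)
have [iota iotaE] := choice (fun x : R => rees_embed_lift b x I0).
have coord_iota r : re (iota r) = r /\ im (iota r) = 0.
  by apply: quadI; rewrite -(embE _).2 iotaE.
have coord_iotaM r a : re (iota r * a) = r * re a /\ im (iota r * a) = r * im a.
  apply: quadI; rewrite -(embE _).2 rmorphM /= iotaE (embE a).2 rmorph0 quadM.
  by rewrite !rmorphM; congr quad; ring.
have coord_sum (T : finType) (F : T -> rees_quot b I) :
    re (\sum_i F i) = \sum_i re (F i) /\ im (\sum_i F i) = \sum_i im (F i).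
  split; apply: (big_morph _ _ _); try by [case: coord0].
    by move=> a c; case: (coordD a c).
  by move=> a c; case: (coordD a c).
have lin_comb (T : finType) (c : T -> R) (F : T -> rees_quot b I) :
    re (\sum_i iota (c i) * F i) = \sum_i c i * re (F i) /\
    im (\sum_i iota (c i) * F i) = \sum_i c i * im (F i).
  have [-> ->] := coord_sum _ (fun i => iota (c i) * F i).
  by split; apply: eq_bigr => i _; have [? ?] := coord_iotaM (c i) (F i).
have JN a : J a -> J (- a) by move=> Ja; rewrite -mulN1r; exact: JM.
pose J_re := [set x | exists a, [/\ J a, re a = x & im a = 0]].
pose J_im := [set y | exists2 a, J a & im a = y].
have [n [g gE]] : fin_gen idfun J_re.
  apply: nR; split=> //.
  - by exists 0; have [] := coord0.
  - move=> _ _ [a [Ja <- a0]] [c [Jc <- c0]]; exists (a + c).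
    by have [? ->] := coordD a c; split; [exact: JD| |rewrite a0 c0 addr0].
  - move=> r _ _ [a [Ja <- a0]]; exists (iota r * a).
    by have [? ->] := coord_iotaM r a; split; [exact: JM| |rewrite a0 mulr0].
have [p [h hE]] : fin_gen idfun J_im.
  apply: nR; split=> //.
  - by exists 0; have [] := coord0.
  - move=> _ _ [a Ja <-] [c Jc <-]; exists (a + c); first exact: JD.
    by have [] := coordD a c.
  - move=> r _ _ [a Ja <-]; exists (iota r * a); first exact: JM.
    by have [] := coord_iotaM r a.
have [ga gaE] := choice (fun i => fin_gen_mem (f := idfun) i gE).
have /choice[ha haE] : forall i, exists a, J a /\ im a = h i.
  by move=> i; have [a Ja im_a] := fin_gen_mem (f := idfun) i hE; exists a.
apply: (@fin_gen2 _ _ idfun J n p ga ha) => a; split; last first.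
  move=> [c [d ->]].
  apply: JD; apply: ideal_sum (iJ) _ => i /=; apply: JM => //.
    by case: (gaE i).
  by case: (haE i).
move=> Ja.
have : J_im (im a) by exists a.
rewrite hE => -[d im_a].
(* Subtracting lifts cancels the coordinate along [alpha], which leaves an element accounted for by
   [J_re]. *)
pose a' := a - \sum_j iota (d j) * ha j.
have Ja' : J a'.
  apply: JD => //; apply: JN; apply: ideal_sum (iJ) _ => i.
  by apply: JM => //; case: (haE i).
have [sre sim] := lin_comb _ d ha.
have im_a' : im a' = 0.
  have [_ ->] := coordD a (- \sum_j iota (d j) * ha j).
  have [_ ->] := coordN (\sum_j iota (d j) * ha j).
  rewrite sim im_a; apply/eqP; rewrite subr_eq0; apply/eqP.
  by apply: eq_bigr => i _; rewrite (haE i).2.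
have : J_re (re a') by exists a'.
rewrite gE => -[c re_a'].
exists (iota \o c), (iota \o d) => /=.
have -> : \sum_i iota (c i) * ga i = a'; last by rewrite subrK.
have [cre cim] := lin_comb _ c ga.
apply: coord_inj.
  rewrite cre re_a'; apply: eq_bigr => i _ /=.
  by case: (gaE i) => _ -> _.
by rewrite cim im_a' big1 // => i _; case: (gaE i) => _ _ ->; rewrite mulr0.
Qed.

End ReesNoetherian.

(** * Integral closure, residue field and values of the quotient *)

Section ReesValuation.
Variables (R : idomainType) (v : {fraction R} -> int) (I : set R) (b : R).
Variable k : int.
Local Notation K := {fraction R}.
Local Notation L := (frac_alpha b).
Local Notation C := (frac_to_alpha b).
Local Notation B := (tofrac b).
Local Notation quad := (quad b).
Local Notation emb := (@rees_quot_embed R b I).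
Local Notation w := (@quad_val R b v).
Hypothesis closR : normalized_valuation_of (integral_closure (@tofrac R)) v.
Hypothesis idealI : is_ideal I.
Hypothesis b0 : b != 0.
Hypothesis vb : v B = 2 * k + 1.

Let dv : discrete_valuation v. Proof. by case: closR. Qed.
Let unitK (x : K) : x != 0 -> x \is a GRing.unit.
Proof. by rewrite unitfE. Qed.
Let unitL (z : L) : z != 0 -> z \is a GRing.unit.
Proof. exact: quad_unit dv b0 vb z. Qed.
Let dw : discrete_valuation w.
Proof. exact: quad_discrete_valuation dv b0 vb. Qed.
Let vgeE := vge_quad dv b0 vb.
Let k_ge0 : 0 <= k.
Proof.
by have := vge_im closR b; rewrite vge_neq0 ?tofrac_eq0 // vb; lia.
Qed.

Let vge_dbl x : vge v 0 x = (x == 0) || (0 <= 2 * v x).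
Proof. by rewrite /vge; congr (_ || _); lia. Qed.
Let vge_dbl1 x : vge v 1 x = (x == 0) || (1 <= 2 * v x).
Proof. by rewrite /vge; congr (_ || _); lia. Qed.

Lemma vge0_quad (x y : K) : vge v 0 x -> vge v 0 y -> vge w 0 (quad x y).
Proof.
by rewrite vgeE /vge; move: k_ge0 => k0 /orP[->|x0] /orP[->|y0] //=; lia.
Qed.

Lemma vge_rees_embed a : vge w 0 (emb a).
Proof.
have [x [y [_ ->]]] := @rees_embed_quad R b I idealI a.
exact: vge0_quad (vge_im closR x) (vge_im closR y).
Qed.

Let I0 : I 0. Proof. by case: idealI. Qed.

Lemma integral_rees_base (x : K) :
  integral_closure (@tofrac R) x -> integral_closure emb (C x).
Proof.
move=> [p mon_p px0].
apply: (@integral_root_monic _ _ emb (C x)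
  (map_poly C (map_poly (@tofrac R) p))).
- by rewrite !monic_map.
- exact: rmorph_root.
move=> z /(nthP 0) [i _ <-]; rewrite !coef_map /= -quadC.
have [a <-] := rees_embed_lift b (p`_i) I0.
exact: integral_id.
Qed.

Lemma rees_integral_closure z : integral_closure emb z <-> vge w 0 z.
Proof.
split; first by apply: vge_integral => //; exact: vge_rees_embed.
have [x [y ->]] := quadP z; rewrite vgeE => /andP[x0 y0].
have int_x : integral_closure emb (C x).
  apply: integral_rees_base; apply/(integral_closure_vge closR).
  by rewrite vge_dbl.
(* The coordinate [y] itself may fail to be integral; only [(y alpha)^2 = b y^2] has a value known
   to be nonnegative. *)
have int_y : integral_closure emb (C (B * y ^+ 2)).
  apply: integral_rees_base; apply/(integral_closure_vge closR).
  have [->|yn0] := eqVneq y 0; first by rewrite expr0n mulr0 vge0.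
  rewrite (negPf yn0) /= in y0.
  rewrite vge_neq0 ?mulf_neq0 ?expf_neq0 ?tofrac_eq0 //.
  by rewrite (dvalM dv) ?expf_neq0 ?tofrac_eq0 // (dvalX unitK dv) // vb; lia.
rewrite quad.unlock; apply: integral_add => //.
(* Transitivity of integrality: [y alpha] is a root of a monic polynomial with integral
   coefficients. *)
apply: (@integral_root_monic _ _ emb _ ('X^2 - (C (B * y ^+ 2))%:P)).
- exact: monicXnsubC.
- rewrite /root hornerD hornerN hornerXn hornerC subr_eq0 exprMn.
  rewrite [X in _ * X]expr2 alpha_sq.
  by rewrite [B * _]mulrC rmorphM rmorphXn.
apply/integral_poly => i; rewrite coefB coefXn coefC.
apply: integral_sub.
  by case: eqP => _; [exact: integral1|exact: integral0].
by case: eqP => _ //; exact: integral0.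
Qed.

Lemma rees_normalized : normalized_valuation_of (integral_closure emb) w.
Proof.
split=> //; rewrite valuation_ringE; apply/seteqP.
by split=> z /rees_integral_closure.
Qed.

(** With [x = p / s], [y = q / t] and a nonzero [i] in [I], the common denominator is [s t i]; the
    factor [i] brings the coefficient [q s i] of [alpha] into [I]. *)
Lemma rees_quot_fraction_field :
  (exists2 x, I x & x != 0) -> is_fraction_field emb.
Proof.
move=> [i Ii i0]; split=> //; first exact: rees_embed_inj.
move=> z; have [x [y ->]] := quadP z.
have [p [s [s0 ->]]] := fraction_exists x.
have [q [t [t0 ->]]] := fraction_exists y.
have [_ _ _ IM] := idealI.
have [a aE] := rees_embed_lift b (p * t * i) (IM (q * s) _ Logic.I Ii).
have [d dE] := rees_embed_lift b (s * t * i) I0.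
have d0 : emb d != 0.
  by rewrite dE quad_eq0 tofrac_eq0 !mulf_eq0 (negPf s0) (negPf t0) (negPf i0).
exists a, d; split; first by apply: contra_neq d0 => ->; rewrite rmorph0.
rewrite -[LHS](mulrK (unitL d0)); congr (_ / _).
rewrite /= aE dE quadM !tofracM rmorph0.
have : tofrac s != 0 by rewrite tofrac_eq0.
have : tofrac t != 0 by rewrite tofrac_eq0.
move: (tofrac s) (tofrac t) (tofrac p) (tofrac q) (tofrac i) => S T P Q J T0 S0.
rewrite !mulr0 addr0 add0r; congr (quad _ _).
  by rewrite -!mulrA mulKf.
by rewrite [LHS]mulrC -!mulrA [T^-1 * _]mulrCA mulKf.
Qed.

Lemma rees_quot_fin_gen : fin_gen (@tofrac R) (integral_closure (@tofrac R)) ->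
  fin_gen emb (integral_closure emb).
Proof.
move=> [n [g Vg]].
have VE x : vge v 0 x <-> exists c : 'I_n -> R, x = \sum_i tofrac (c i) * g i.
  by rewrite -(integral_closure_vge closR) Vg.
have gV i : vge v 0 (g i).
  apply/(integral_closure_vge closR).
  exact: (fin_gen_mem (f := @tofrac R) i Vg).
(* For integers, [2 * v y + 2 * k + 1 >= 0] amounts to [v y >= - k], so the admissible [y] are [e]
   times the integral closure of [R]. *)
have [e e0 ve] := dval_surj dv (- k).
have [iota iotaE] := choice (fun x : R => rees_embed_lift b x I0).
apply: (@fin_gen2 _ _ emb _ n n
  (fun i => C (g i)) (fun i => C (e * g i) * alpha b)).
have sumE (c d : 'I_n -> R) :
    \sum_i emb (iota (c i)) * C (g i) +
    \sum_i emb (iota (d i)) * (C (e * g i) * alpha b) =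
    quad (\sum_i tofrac (c i) * g i) (e * \sum_i tofrac (d i) * g i).
  rewrite mulr_sumr quad.unlock !rmorph_sum mulr_suml /=.
  congr (_ + _); apply: eq_bigr => i _; rewrite iotaE rmorph0 quadC.
    by rewrite rmorphM.
  by rewrite mulrA [e * (_ * _)]mulrCA [in RHS]rmorphM.
move=> z; split=> [/rees_integral_closure|[c [d ->]]].
  have [x [y ->]] := quadP z; rewrite vgeE => /andP[x0 y0].
  have /VE[c xE] : vge v 0 x by rewrite vge_dbl.
  have /VE[d yE] : vge v 0 (y / e).
    have [->|yn0] := eqVneq y 0; first by rewrite mul0r vge0.
    rewrite (negPf yn0) /= in y0.
    rewrite vge_neq0 ?mulf_neq0 ?invr_eq0 //.
    by rewrite (dvalM dv) ?invr_eq0 // (dvalV unitK dv) // ve; lia.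
  exists (iota \o c), (iota \o d); rewrite sumE -xE -yE.
  by rewrite mulrC divfK.
have ga0 i : vge w 0 (C (g i)).
  by rewrite -quadC; apply: vge0_quad => //; exact: vge0.
have ge0 i : vge w 0 (C (e * g i) * alpha b).
  have -> : C (e * g i) * alpha b = quad 0 (e * g i).
    by rewrite quad.unlock rmorph0 add0r.
  rewrite vgeE eqxx /=.
  have := vgeM unitK dv (vgexx v e) (gV i); rewrite ve /vge.
  by case/orP=> [->//|]; lia.
apply/rees_integral_closure; apply: (vgeD dw); apply: (vge_sum dw) => i;
  by rewrite -[0]add0r; apply: (vgeM unitL dw) => //; exact: vge_rees_embed.
Qed.

Lemma rees_quot_residually_rational :
  (exists2 x, I x & x != 0) ->
  residually_rational (@tofrac R) -> residually_rational emb.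
Proof.
move=> nzI; have fracR := tofrac_is_fraction_field R.
rewrite (residually_rationalE fracR closR) => rrR.
have fracS := rees_quot_fraction_field nzI.
apply/(residually_rationalE fracS rees_normalized) => z.
have [x [y ->]] := quadP z; rewrite vgeE => /andP[x0 y0].
have [|c xc] := rrR x; first by rewrite vge_dbl.
have [a aE] := rees_embed_lift b c I0.
exists a; rewrite /= aE quadB rmorph0 subr0 vgeE.
apply/andP; split; first by rewrite -vge_dbl1.
(* The part along [alpha] has odd value, so a nonnegative value is already positive; only [x] has to
   be approximated by an element of [R]. *)
by case/orP: y0 => [->//|y0]; apply/orP; right; lia.
Qed.

(** The value of [x + y alpha] is that of one of its two terms, and each term alone belongs to the
    ring. *)
Lemma rees_quot_values : values w (range emb) =
  numerical_duplication (values v (range (@tofrac R)))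
    (values v (@tofrac R @` I)) (v B).
Proof.
rewrite vb; apply/seteqP; split=> n.
  move=> [_ [[a _ <-] + <-]].
  have [x [y [Iy ->]]] := @rees_embed_quad R b I idealI a.
  move=> xy0; have [[x0 ->]|[y0 ->]] := quad_val_neq0 dv b0 vb xy0.
    left; exists (v (tofrac x)) => //.
    by exists (tofrac x); split=> //; exists x.
  right; exists (v (tofrac y)) => //.
  by exists (tofrac y); split=> //; exists y.
move=> [[_ [_ [[x _ <-] x0 <-]] <-]|[_ [_ [[y Iy <-] y0 <-]] <-]].
  have xy0 : quad (tofrac x) 0 != 0 by rewrite quad_eq0 eqxx andbT.
  exists (quad (tofrac x) 0); split=> //.
    by have [a aE] := rees_embed_lift b x I0; exists a; rewrite // aE rmorph0.
  by have [[_ ->]|[]] := quad_val_neq0 dv b0 vb xy0; rewrite ?eqxx.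
have xy0 : quad 0 (tofrac y) != 0 by rewrite quad_eq0 eqxx.
exists (quad 0 (tofrac y)); split=> //.
  by have [a aE] := rees_embed_lift b 0 Iy; exists a; rewrite // aE rmorph0.
by have [[]|[_ ->]] := quad_val_neq0 dv b0 vb xy0; rewrite ?eqxx.
Qed.

End ReesValuation.

(** The closure is taken in a ring given as a parameter, so the clause [is_fraction_field] certifies
    that [frac_alpha b] is the right one. The condition [b != 0] is explicit because [v] is
    unconstrained at 0. *)
Theorem theorem3p1 (R : idomainType) (v : {fraction R} -> int)
    (I : set R) (b : R) :
  noetherian_1dim_local_domain R ->
  analytically_irreducible (@tofrac R) ->
  residually_rational (@tofrac R) ->
  2%N \notin [pchar R] ->
  normalized_valuation_of (integral_closure (@tofrac R)) v ->
  is_ideal I -> (exists2 x, I x & x != 0) ->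
  b != 0 -> odd `|v (tofrac b)|%N ->
  [/\ noetherian_1dim_local_domain (rees_quot b I),
      is_fraction_field (@rees_quot_embed R b I),
      analytically_irreducible (@rees_quot_embed R b I),
      residually_rational (@rees_quot_embed R b I)
    & forall v' : frac_alpha b -> int,
        normalized_valuation_of (integral_closure (@rees_quot_embed R b I)) v' ->
        [/\ forall x : {fraction R}, x != 0 ->
              v' (frac_to_alpha b x) = 2 * v x,
            v' (alpha b) = v (tofrac b)
          & values v' (range (@rees_quot_embed R b I)) =
            numerical_duplication (values v (range (@tofrac R)))
              (values v (@tofrac R @` I)) (v (tofrac b))]].
Proof.
move=> [_ nR _ _] [_ fgV] rrR _ closR idealI nzI b0 odd_vb.
have [k vb] : exists k, v (tofrac b) = 2 * k + 1.
  by exists ((v (tofrac b) - 1) %/ 2)%Z; lia.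
have [dv _] := closR.
have fracS := rees_quot_fraction_field closR idealI b0 vb nzI.
have closS := rees_normalized closR idealI b0 vb.
have fgS := rees_quot_fin_gen closR idealI b0 vb fgV.
have [dw _] := closS; have [unitL _ _] := fracS.
split=> //.
- apply: (valuation_domain_1dim fracS closS) => //.
  exact: rees_quot_noetherian.
- by split=> //; exists (quad_val v).
- exact: rees_quot_residually_rational closR idealI b0 vb nzI rrR.
move=> v' [dv' closS'].
(* By uniqueness, any normalized valuation of the closure is computed by the norm. *)
have v'E z : z != 0 -> v' z = quad_val v z.
  apply: valuation_unique => //; rewrite -closS'.
  by case: closS.
have alpha0 : quad b 0 1 != 0 by rewrite quad_eq0 eqxx oner_eq0.
split.
- move=> x x0; have Cx0 : quad b x 0 != 0 by rewrite quad_eq0 eqxx andbT.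
  rewrite -quadC v'E //.
  by have [[_ ->]|[]] := quad_val_neq0 dv b0 vb Cx0; rewrite ?eqxx.
- rewrite -quad_alpha v'E //.
  have [[]|[_ ->]] := quad_val_neq0 dv b0 vb alpha0; first by rewrite eqxx.
  by rewrite (dval1 dv) vb mulr0 add0r.
rewrite -(rees_quot_values closR idealI b0 vb); apply/seteqP.
by split=> n [z [Sz z0 <-]]; exists z; split=> //; rewrite v'E.
Qed.
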